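(* Let $R=k[x_0,\ldots,x_n]$ be a polynomial ring over a field $k$ of any characteristic, let $s>2$ be an integer, and let $\mathcal F=\{F_1,\ldots,F_s\}$ be a set of $s$ forms in $R$ such that any three of them form a regular sequence. Let $I_2=\bigcap_{1\le i<j\le s}(F_i,F_j)$, let $G:=F_1F_2\cdots F_s$ and, for any $1\le i\le s$, let $G_i:=G/F_i=\prod_{j\ne i}F_j$. Then for any $m\ge1$: (1) (a) A minimal generating set of $I_2^{(m)}$ is given by $$\mathbf G_{2,(m)}=\{G^jG_i^{m-2j} \mid 0\le j\le\lfloor\tfrac m2\rfloor,\ i=1,\ldots,s\}.$$ (b) $\mu(I_2^{(m)})=s+s\lfloor\frac m2\rfloor$ if $m$ is odd, and $\mu(I_2^{(m)})=1+\frac{ms}{2}$ if $m$ is even. (2) (a) A minimal generating set of $I_2^{(m)}/I_2^m$ as an $R$-module is given by (the images of) $$\mathbf G_{2,(m)}'=\{G^jG_i^{m-2j} \mid 1\le j\le\lfloor\tfrac m2\rfloor,\ i=1,\ldots,s\}.$$ (b) $\mathrm{sdefect}(I_2,m)=s\lfloor\frac m2\rfloor$ if $m$ is odd, and $\mathrm{sdefect}(I_2,m)=1+s\left(\frac m2-1\right)$ if $m$ is even.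
   Context: For a homogeneous ideal $I\subseteq R$ and $m\ge1$, $I^{(m)}=\bigcap_{P\in \mathrm{Ass}(R/I)}(I^mR_P\cap R)$. $\mu(U)$ is the minimal number of generators of a finitely generated graded $R$-module $U$, and $\mathrm{sdefect}(I,m):=\mu(I^{(m)}/I^m)$. The generating sets are sets of elements (repetitions are not counted). *)

(* Defs.v *)
From mathcomp Require Export all_boot all_order all_algebra fraction.
From mathcomp Require Export mpoly.
From mathcomp Require Export boolp classical_sets functions cardinality.

Set Implicit Arguments.
Unset Strict Implicit.
Unset Printing Implicit Defensive.

Import GRing.Theory.

Local Open Scope ring_scope.
Local Open Scope classical_set_scope.

Section IdealTheory.
Variable R : idomainType.
Implicit Types (S T I J M N P : set R) (m r : nat).

Definition ideal_span S : set R :=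
  [set x | exists r (c g : 'I_r -> R),
     (forall i, S (g i)) /\ x = \sum_(i < r) c i * g i].

Definition is_ideal I : Prop :=
  [/\ I 0, forall x y, I x -> I y -> I (x + y)
         & forall a x, I x -> I (a * x)].

Definition ideal_pow I m : set R :=
  ideal_span [set x | exists a : 'I_m -> R,
     (forall i, I (a i)) /\ x = \prod_(i < m) a i].

Definition regular_sequence (fs : seq R) : Prop :=
  (forall i, (i < size fs)%N -> forall a,
     ideal_span [set` take i fs] (a * fs`_i) -> ideal_span [set` take i fs] a)
  /\ ~ ideal_span [set` fs] 1.

Definition prime_ideal P : Prop :=
  [/\ is_ideal P, ~ P 1 & forall x y, P (x * y) -> P x \/ P y].

(* Ass(R/I): the annihilator in R of the class of f in R/I is the set of all x
   such that x * f lies in I. *)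
Definition assoc_primes I : set (set R) :=
  [set P | prime_ideal P /\ exists f, P = [set x | I (x * f)]].

(* Since R is a domain, the localization R_P at a prime P is taken as a subring
   of the fraction field of R. *)
Definition localization P : set {fraction R} :=
  [set x | exists a b, ~ P b /\ x = tofrac a / tofrac b].

(* J R_P, the ideal of R_P generated by the image of J. *)
Definition extension J P : set {fraction R} :=
  [set x | exists r (c : 'I_r -> {fraction R}) (g : 'I_r -> R),
     (forall i, localization P (c i) /\ J (g i)) /\
     x = \sum_(i < r) c i * tofrac (g i)].

Definition symbolic_power I m : set R :=
  \bigcap_(P in assoc_primes I)
     [set x | extension (ideal_pow I m) P (tofrac x)].

(* For ideals M `<=` N, a subset S of N represents the set of its images in the
   R-module N / M.  The following definitions are about this module; an ideal N
   itself is the case M = [set 0]. *)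
Definition generates N M S : Prop :=
  S `<=` N /\ forall x, N x -> exists2 y, ideal_span S y & M (x - y).

Definition minimal_generating_set N M S : Prop :=
  generates N M S /\ forall T, T `<` S -> ~ generates N M T.

(* mu(N / M) = r *)
Definition mu_eq N M r : Prop :=
  (exists S, generates N M S /\ (S #= `I_r)%card) /\
  (forall S r', generates N M S -> (S #= `I_r')%card -> (r <= r')%N).

(* sdefect(I, m) = r *)
Definition sdefect_eq I m r : Prop :=
  mu_eq (symbolic_power I m) (ideal_pow I m) r.

End IdealTheory.

Section StarConfiguration.
Variables (R : idomainType) (s : nat) (F : 'I_s -> R).

Definition star_ideal2 : set R :=
  \bigcap_(p in [set p : 'I_s * 'I_s | (p.1 < p.2)%N])
     ideal_span [set F p.1; F p.2].

Definition prod_all : R := \prod_(j < s) F j.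
Definition prod_but (i : 'I_s) : R := \prod_(j < s | j != i) F j.

(* All G^j G_i^(m - 2j) with j0 <= j <= floor(m/2); as j <= m./2, the truncated
   subtraction is exact. *)
Definition star_gens (j0 m : nat) : set R :=
  [set x | exists (j : nat) (i : 'I_s), (j0 <= j <= m./2)%N /\
     x = prod_all ^+ j * prod_but i ^+ (m - j.*2)].

End StarConfiguration.

(* Main.v *)
Require Import Defs.
From mathcomp Require Import ring zify.
Set Implicit Arguments.
Unset Strict Implicit.
Unset Printing Implicit Defensive.
Import GRing.Theory Order.TTheory.
Local Open Scope ring_scope.
Local Open Scope classical_set_scope.

(** Write [G] for the product of all the forms, [G_i] for the product of the
    forms other than [F_i], [I] for [star_ideal2 F], [Q_ij] for the ideal
    [(F_i, F_j)] and [J_m] for the intersection of all the powers [Q_ij^m].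

    The symbolic power [I^(m)] is [J_m] ([symbolic_powerE]).  An associated prime
    [P = (I : f)] contains at most two of the forms: if [f] is not in [Q_ab],
    then no form other than [F_a] and [F_b] lies in [P], because it is a
    nonzerodivisor modulo [Q_ab].  Inverting the other forms turns [I^m] into
    [Q_ab^m], hence [J_m] is contained in [I^(m)].  Conversely, if [x] is not in
    [Q_ab^m], then regularity yields some [g] outside [Q_ab] such that every [b]
    with [b x] in [Q_ab^m] satisfies [b g] in [Q_ab] ([pair_pow_witness]).  As
    the polynomial ring is Noetherian, some multiple of [g] has a prime colon
    ideal [P] over [Q_ab]; this [P] is also associated to [I], and no [b]
    outside [P] brings [b x] into [I^m].

    The generators of [J_m] come from one reduction ([star_pow_decomp]):
    modulo [F_i], an element of [J_m] lies in every [(F_j^m)] with [j != i], and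
    any two of the [F_j] are regular modulo [F_i], so it is a multiple
    [c_i G_i^m].  Then [x - sum_i c_i G_i^m] vanishes modulo every [F_i], since
    [F_i] divides [G_j] for [j != i], so it equals [G z] for some [z].
    For [m >= 2], cancelling [F_a F_b] in [Q_ab^m] shows that [z] lies in
    [J_(m-2)], and induction on [m] ends the argument ([star_pow_span]).

    For minimality, [ev] is a ring morphism to a field that kills the forms (for
    polynomials, the constant coefficient).  A relation among the generators
    has all its coefficients in the kernel of [ev] ([star_syzygy]): modulo [F_i]
    only [G_i^m] survives, so its coefficient is divisible by [F_i]; this makes
    the whole relation divisible by [G], and the quotient is a relation for
    [m - 2] whose coefficients have changed by multiples of the [G_i] only.
    Since [G_a G_b] is [G] times a product of at least one form when [2 < s], the
    ordinary power [I^m] is spanned by the [G_i^m] up to combinations of the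
    generators with coefficients in the kernel of [ev] ([ideal_pow_sub]), so the
    same independence holds for the generators with [1 <= j] modulo [I^m].
    Independence in this sense implies minimality, and a comparison of ranks
    over the field gives the minimal number of generators, as in the lemma of
    Nakayama ([free_minimal], [free_mu]). *)

(** * Regular elements and powers of an ideal generated by two elements *)

Section RegularElements.
Variable R : idomainType.
Implicit Types A B C a b c x y z : R.

Definition in_pair A B x := exists a b, x = a * A + b * B.

Definition regular3 A B C := forall a, in_pair A B (a * C) -> in_pair A B a.

(** Regularity modulo the principal ideal [(A)] is the case of the pair [(0, A)],
    so that the lemmas on [regular3] cover both. *)
Definition regular2 := regular3 0.

Lemma in_pair0 B x : in_pair 0 B x <-> exists c, x = c * B.
Proof.
split=> [[a [b ->]]|[c ->]]; first by exists b; rewrite mulr0 add0r.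
by exists 0, c; rewrite mulr0 add0r.
Qed.

Lemma in_pairM A B c x : in_pair A B x -> in_pair A B (c * x).
Proof. by move=> [a [b ->]]; exists (c * a), (c * b); ring. Qed.

Lemma in_pairB A B x y : in_pair A B x -> in_pair A B y -> in_pair A B (x - y).
Proof. by move=> [a [b ->]] [a' [b' ->]]; exists (a - a'), (b - b'); ring. Qed.

Lemma in_pairl A B a : in_pair A B (a * A).
Proof. by exists a, 0; rewrite mul0r addr0. Qed.

Lemma in_pairr A B b : in_pair A B (b * B).
Proof. by exists 0, b; rewrite mul0r add0r. Qed.

Lemma regular2P A B a b : regular2 A B -> a * B = b * A -> exists c, a = c * A.
Proof. by move=> rAB e; apply/in_pair0/rAB/in_pair0; exists b. Qed.

Lemma regular3_prod A B (I : Type) (r : seq I) (P : pred I) (f : I -> R) :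
  (forall i, P i -> regular3 A B (f i)) -> regular3 A B (\prod_(i <- r | P i) f i).
Proof.
move=> rf; elim/big_ind: _ => [a|C D rC rD a|//]; first by rewrite mulr1.
by rewrite mulrA => /rD/rC.
Qed.

Lemma regular3_exp A B C m : regular3 A B C -> regular3 A B (C ^+ m).
Proof.
move=> rC; elim: m => [|m IH] a; first by rewrite mulr1.
by rewrite exprSr mulrA => /rC/IH.
Qed.

(** Permutability of a regular sequence, with no local or graded hypothesis: from
    [a C = b A + c B], regularity of [B] modulo [(A, C)] gives [c = d A + f C], and
    then [C (a - f B)] is a multiple of [A]. *)
Lemma regular3_swap A B C : regular2 A C -> regular3 A C B -> regular3 A B C.
Proof.
move=> rAC rACB a [b [c e]].
have [|d [f ec]] := rACB c; first by exists (- b), a; rewrite e; ring.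
have [|g eg] := @regular2P _ _ (a - f * B) (b + d * B) rAC.
  by rewrite mulrBl e ec; ring.
by exists g, f; rewrite -eg; ring.
Qed.

(** If pairwise regular elements [f i] modulo [A] all divide [x] modulo [A], then so
    does their product.  With [A = 0] this computes an intersection of principal
    ideals. *)
Lemma inter_pairs A (I : eqType) (f : I -> R) (r : seq I) x :
  uniq r -> {in r &, forall i j, i != j -> regular3 A (f i) (f j)} ->
  {in r, forall i, in_pair A (f i) x} -> in_pair A (\prod_(i <- r) f i) x.
Proof.
elim: r => [|i r IH] /=; first by exists 0, x; rewrite big_nil; ring.
move=> /andP[ir ur] reg xr.
have [||b [c ex]] := IH ur.
- by move=> j l jr lr; apply: reg; rewrite inE ?jr ?lr orbT.
- by move=> j jr; apply: xr; rewrite inE jr orbT.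
have [d [e ec]] : in_pair A (f i) c.
  suff rp : regular3 A (f i) (\prod_(j <- r) f j).
    apply: rp; rewrite (_ : c * _ = x - b * A); last by rewrite ex; ring.
    by apply: in_pairB (in_pairl _ _ _); apply: xr; rewrite mem_head.
  rewrite big_seq; apply: regular3_prod => j jr; apply: reg.
  - exact: mem_head.
  - by rewrite inE jr orbT.
  - by apply: contraNneq ir => ->.
by exists (b + d * \prod_(j <- r) f j), e; rewrite big_cons ex ec; ring.
Qed.

(** The ideal [(A, B)^m].  The recursion [Q^(m+1) = A Q^m + B Q^m] makes it visibly
    symmetric in [A] and [B] and suits induction on [m]. *)
Fixpoint pair_pow A B (m : nat) : set R :=
  if m is m'.+1 then
    [set x | exists y z, [/\ pair_pow A B m' y, pair_pow A B m' z & x = A * y + B * z]]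
  else setT.

Section PairPow.
Variables A B : R.
Notation Q := (pair_pow A B).

Lemma pair_pow1P x : Q 1 x <-> in_pair A B x.
Proof.
split=> [[y [z [_ _ ->]]]|[a [b ->]]]; last by exists a, b; split=> //; ring.
by exists y, z; ring.
Qed.

Lemma pair_pow_ideal m : is_ideal (Q m).
Proof.
elim: m => [|m [Q0 QD QM]]; first by split.
split=> [|x y|a x].
- by exists 0, 0; split=> //; ring.
- move=> [x1 [x2 [h1 h2 ->]]] [y1 [y2 [h3 h4 ->]]].
  by exists (x1 + y1), (x2 + y2); split; [exact: QD|exact: QD|ring].
- move=> [x1 [x2 [h1 h2 ->]]].
  by exists (a * x1), (a * x2); split; [exact: QM|exact: QM|ring].
Qed.

Lemma pair_powD m x y : Q m x -> Q m y -> Q m (x + y).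
Proof. by case: (pair_pow_ideal m) => _ + _; apply. Qed.

Lemma pair_powMl m a x : Q m x -> Q m (a * x).
Proof. by case: (pair_pow_ideal m) => _ _; apply. Qed.

Lemma pair_powB m x y : Q m x -> Q m y -> Q m (x - y).
Proof. by move=> hx hy; apply: pair_powD => //; rewrite -mulN1r; apply: pair_powMl. Qed.

Lemma pair_pow_mulA m x : Q m x -> Q m.+1 (A * x).
Proof.
by have [Q0 _ _] := pair_pow_ideal m; exists x, 0; split=> //; ring.
Qed.

Lemma pair_pow_mulB m x : Q m x -> Q m.+1 (B * x).
Proof.
by have [Q0 _ _] := pair_pow_ideal m; exists 0, x; split=> //; ring.
Qed.

Lemma pair_pow_mul i j x y : Q i x -> Q j y -> Q (i + j) (x * y).
Proof.
move=> + hy; elim: i x => [|i IH] x; first by move=> _; apply: pair_powMl.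
move=> [u [v [/IH hu /IH hv ->]]]; exists (u * y), (v * y).
by split=> //; ring.
Qed.

Lemma pair_powX m i x : Q m x -> Q (m * i) (x ^+ i).
Proof.
move=> hx; elim: i => [|i IH]; first by rewrite muln0.
by rewrite mulnS exprS; apply: pair_pow_mul.
Qed.

Lemma pair_powS m x : Q m.+1 x -> Q m x.
Proof. by move=> [y [z [hy hz ->]]]; apply: pair_powD; apply: pair_powMl. Qed.

Lemma pair_powBX c m : Q m (c * B ^+ m).
Proof.
apply: pair_powMl; elim: m => [//|m IH]; rewrite exprS.
exact: pair_pow_mulB.
Qed.

(** All the multiples of [A] can be gathered, which leaves one pure power of [B]; its
    coefficient is then controlled by regularity modulo [A]. *)
Lemma pair_pow_normal m x : Q m.+1 x ->
  exists y c, Q m y /\ x = A * y + c * B ^+ m.+1.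
Proof.
elim: m x => [|m IH] x [y [z [hy hz ->]]].
  by exists y, z; split=> //; ring.
have [y' [c [hy' ->]]] := IH z hz.
exists (y + B * y'), c; split; last by rewrite [in RHS]exprS; ring.
by apply: pair_powD => //; apply: pair_pow_mulB.
Qed.

(** Regularity of [B] modulo [A] makes [A] regular of degree one on the graded ring
    of [(A, B)]: in the normal form of [A z] the coefficient of [B^(m+1)] is
    divisible by [A]. *)
Lemma pair_pow_cancelA m z : A != 0 -> regular2 A B -> Q m.+1 (A * z) -> Q m z.
Proof.
move=> A0 rAB /pair_pow_normal[y [c [hy e]]].
have [|d ed] := @regular2P _ (B ^+ m.+1) c (z - y) (regular3_exp (m := m.+1) rAB).
  by apply/eqP; rewrite -subr_eq0; apply/eqP; rewrite mulrBl (mulrC z) e; ring.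
have -> : z = y + d * B ^+ m.+1.
  by apply: (mulfI A0); rewrite e ed; ring.
apply: pair_powD => //; exact/pair_powS/pair_powBX.
Qed.

(** An element that is regular modulo [(A, B)] stays regular modulo the powers of
    [(A, B)]: the coefficient of [B^(m+1)] in the normal form of [z C] lies in
    [(A, C)], so that [z] can be corrected to a multiple [A w] with [w C] in
    [(A, B)^m]. *)
Lemma pair_pow_cancel C m z : A != 0 -> regular2 A C -> regular3 A C B ->
  Q m (z * C) -> Q m z.
Proof.
move=> A0 rAC rACB; elim: m z => [//|m IH] z /pair_pow_normal[y [c [hy e]]].
have [|d [f ec]] := regular3_exp (m := m.+1) rACB (a := c).
  by exists (- y), z; rewrite e; ring.
have [|w ew] := @regular2P _ C (z - f * B ^+ m.+1) (y + d * B ^+ m.+1) rAC.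
  by rewrite mulrBl e ec; ring.
have -> : z = A * w + f * B ^+ m.+1.
  by rewrite -(subrK (f * B ^+ m.+1) z) ew; ring.
apply: pair_powD; last exact: pair_powBX.
apply/pair_pow_mulA/IH.
have -> : w * C = y + d * B ^+ m.+1.
  apply: (mulfI A0); apply: (addIr (f * B ^+ m.+1 * C)).
  by transitivity (z * C); [rewrite -(subrK (f * B ^+ m.+1) z) ew; ring | rewrite e ec; ring].
by apply: pair_powD => //; apply/pair_powS/pair_powBX.
Qed.

(** The powers of [(A, B)] acquire no associated prime beyond those of [(A, B)]: the
    element [g] is a coefficient outside [(A, B)] of the initial form of [x].  It is
    found by peeling off the pure power of [B] in the normal form, or, if the
    coefficient of this power lies in [(A, B)], by dividing the rest by [A]. *)
Lemma pair_pow_witness m x : A != 0 -> regular2 A B -> ~ Q m x ->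
  exists2 g, ~ Q 1 g & forall b, Q m (b * x) -> Q 1 (b * g).
Proof.
move=> A0 rAB; elim: m x => [|m IH] x nx; first by case: nx.
have [xm|/IH[g ng hg]] := pselect (Q m x); last first.
  by exists g => // b /pair_powS/hg.
case: m IH nx xm => [|m] IH nx xm; first by exists x.
have [y [c [hy ex]]] := pair_pow_normal xm.
have [cQ|ncQ] := pselect (Q 1 c); last first.
  exists c => // b /pair_pow_normal[y' [c' [_ e]]].
  have [|d ed] := @regular2P _ (B ^+ m.+1) (b * c - c' * B) (y' - b * y)
                             (regular3_exp (m := m.+1) rAB).
    apply: (addIr (c' * B ^+ m.+2 + b * (A * y))).
    by transitivity (b * x); [rewrite ex (exprS B m.+1); ring | rewrite e; ring].
  by apply/pair_pow1P; exists d, c'; rewrite -ed; ring.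
have cB : Q m.+2 (c * B ^+ m.+1).
  by rewrite -add1n; apply: pair_pow_mul => //; rewrite -[B ^+ _]mul1r; apply: pair_powBX.
have [ym|g ng hg] := IH y; first by apply: nx; rewrite ex; apply: pair_powD => //; apply: pair_pow_mulA.
exists g => // b hb; apply/hg/pair_pow_cancelA => //.
rewrite (_ : A * _ = b * x - b * (c * B ^+ m.+1)); last by rewrite ex; ring.
by apply: pair_powB => //; apply: pair_powMl.
Qed.

End PairPow.

Lemma pair_pow_sym A B m : pair_pow A B m `<=` pair_pow B A m.
Proof.
elim: m => [//|m IH] x [y [z [/IH hy /IH hz ->]]].
by exists z, y; split=> //; rewrite addrC.
Qed.

End RegularElements.

(** * Elementary ideal theory *)

Section Ideals.
Variable R : idomainType.
Implicit Types (I S : set R) (a x y : R).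

Lemma ideal_sum I (K : Type) (r : seq K) (P : pred K) (f : K -> R) :
  is_ideal I -> (forall i, P i -> I (f i)) -> I (\sum_(i <- r | P i) f i).
Proof. by move=> [I0 ID _] fI; elim/big_ind: _ => //; apply: ID. Qed.

Lemma idealM I a x : is_ideal I -> I x -> I (a * x).
Proof. by case=> _ _; apply. Qed.

Lemma idealD I x y : is_ideal I -> I x -> I y -> I (x + y).
Proof. by case=> _ + _; apply. Qed.

Lemma idealB I x y : is_ideal I -> I x -> I y -> I (x - y).
Proof. by move=> hI hx hy; apply: idealD => //; rewrite -mulN1r; apply: idealM. Qed.

Lemma ideal_spanP (K : finType) (g : K -> R) x :
  ideal_span (range g) x <-> exists c : K -> R, x = \sum_k c k * g k.
Proof.
split=> [[r [c [h [hg ->]]]]|[c ->]].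
  have /choice[f hf] : forall i, exists k, h i = g k.
    by move=> i; have [k _ <-] := hg i; exists k.
  exists (fun k => \sum_(i | f i == k) c i).
  rewrite (partition_big f xpredT) //=; apply: eq_bigr => k _.
  by rewrite mulr_suml; apply: eq_bigr => i /eqP <-; rewrite hf.
exists #|K|, (c \o enum_val), (g \o enum_val); split; first by move=> i; exists (enum_val i).
by rewrite (big_enum_val (A := K)).
Qed.

Lemma mem_ideal_span S x : S x -> ideal_span S x.
Proof. by move=> Sx; exists 1%N, (fun=> 1), (fun=> x); split=> //; rewrite big_ord1 mul1r. Qed.

Lemma ideal_span_min I S : is_ideal I -> S `<=` I -> ideal_span S `<=` I.
Proof.
move=> hI SI x [r [c [g [Sg ->]]]].
by apply: ideal_sum => // i _; apply: idealM => //; apply: SI.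
Qed.

Lemma ideal_span_ideal S : is_ideal (ideal_span S).
Proof.
split.
- by exists 0%N, (fun=> 0), (fun=> 0); split=> [[]//|]; rewrite big_ord0.
- move=> x y [r [c [g [Sg ->]]]] [r' [c' [g' [Sg' ->]]]].
  exists (r + r')%N, (fun i => match fintype.split i with inl j => c j | inr j => c' j end),
    (fun i => match fintype.split i with inl j => g j | inr j => g' j end); split.
    by move=> i; case: (fintype.split i).
  rewrite big_split_ord /=; congr (_ + _); apply: eq_bigr => i _.
    by rewrite (unsplitK (inl _ i)).
  by rewrite (unsplitK (inr _ i)).
- move=> a x [r [c [g [Sg ->]]]]; exists r, (fun i => a * c i), g; split=> //.
  by rewrite mulr_sumr; apply: eq_bigr => i _; rewrite mulrA.
Qed.

Lemma ideal_span_sub S S' : S `<=` S' -> ideal_span S `<=` ideal_span S'.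
Proof.
move=> SS'; apply: ideal_span_min; first exact: ideal_span_ideal.
by move=> x /SS'/mem_ideal_span.
Qed.

Lemma ideal_pow_ideal I m : is_ideal (ideal_pow I m).
Proof. exact: ideal_span_ideal. Qed.

Lemma ideal_pow_mul I m x y : I x -> ideal_pow I m y -> ideal_pow I m.+1 (x * y).
Proof.
move=> Ix [r [c [g [hg ->]]]]; rewrite mulr_sumr.
have hI := ideal_pow_ideal I m.+1.
apply: ideal_sum => // l _; rewrite mulrCA; apply: idealM => //.
apply: mem_ideal_span; have [d [hd ->]] := hg l.
exists (fun j => if unlift ord0 j is Some j' then d j' else x); split.
  by move=> j; case: unlift => //.
rewrite big_ord_recl unlift_none; congr (_ * _); apply: eq_bigr => j _.
by rewrite liftK.
Qed.

Lemma ideal_pow0 I x : ideal_pow I 0 x.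
Proof.
rewrite -[x]mulr1; apply: idealM; first exact: ideal_pow_ideal.
by apply: mem_ideal_span; exists (fun=> 0); split=> [[]//|]; rewrite big_ord0.
Qed.

Lemma ideal_powX I m x : I x -> ideal_pow I m (x ^+ m).
Proof.
move=> Ix; elim: m => [|m IH]; first exact: ideal_pow0.
by rewrite exprS; apply: ideal_pow_mul.
Qed.

Lemma in_pair_ideal A B : is_ideal (@in_pair R A B).
Proof.
split=> [|x y [a [b ->]] [a' [b' ->]]|c x]; last exact: in_pairM.
  by exists 0, 0; ring.
by exists (a + a'), (b + b'); ring.
Qed.

Lemma ideal_span2P A B x : ideal_span [set A; B] x <-> in_pair A B x.
Proof.
split=> [|[a [b ->]]].
  apply: ideal_span_min; first exact: in_pair_ideal.
  by move=> y [->|->]; [exists 1, 0|exists 0, 1]; ring.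
have hI := ideal_span_ideal [set A; B].
by apply: idealD => //; apply: idealM => //; apply: mem_ideal_span; [left|right].
Qed.

End Ideals.

(** * Generators of the intersection of the powers *)

Section StarPow.
Variables (R : idomainType) (s : nat) (F : 'I_s -> R).
Hypothesis hs : (2 < s)%N.
Hypothesis F0 : forall i, F i != 0.
Hypothesis reg2 : forall i j, i != j -> regular2 (F i) (F j).
Hypothesis reg3 : forall i j l, i != j -> i != l -> j != l -> regular3 (F i) (F j) (F l).
Notation G := (prod_all F).
Notation G_ := (prod_but F).

Definition prod_but2 (a b : 'I_s) : R := \prod_(l | (l != a) && (l != b)) F l.

Lemma prod_allE i : G = F i * G_ i.
Proof. by rewrite /prod_all (bigD1 i). Qed.

Lemma prod_butE a b : a != b -> G_ a = F b * prod_but2 a b.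
Proof. by move=> ab; rewrite /prod_but (bigD1 b) // eq_sym. Qed.

Lemma prod_but2_sym a b : prod_but2 a b = prod_but2 b a.
Proof. by apply: eq_bigl => l; rewrite andbC. Qed.

Lemma prod_all_neq0 : G != 0.
Proof. by apply/prodf_neq0. Qed.

(** The source of the redundancy between ordinary and symbolic powers: a product of
    two different [G_i] is divisible by [G]. *)
Lemma prod_butM a b : a != b -> G_ a * G_ b = prod_but2 a b * G.
Proof.
by move=> ab; rewrite (prod_allE b) (prod_butE ab) mulrCA !mulrA.
Qed.

Lemma regular_prod_but i m : regular2 (F i) (G_ i ^+ m).
Proof.
by apply/regular3_exp/regular3_prod => j ji; apply: reg2; rewrite eq_sym.
Qed.

Lemma regular_prod_but2 a b : a != b -> regular3 (F a) (F b) (prod_but2 a b).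
Proof.
by move=> ab; apply: regular3_prod => l /andP[la lb]; apply: reg3; rewrite // eq_sym.
Qed.

(** A description of the [m]-th symbolic power without localization, see
    [symbolic_powerE]. *)
Definition star_pow (m : nat) : set R :=
  [set x | forall i j, i != j -> pair_pow (F i) (F j) m x].

Lemma star_pow_ideal m : is_ideal (star_pow m).
Proof.
split=> [i j _|x y hx hy i j ij|a x hx i j ij].
- by case: (pair_pow_ideal (F i) (F j) m).
- by apply: pair_powD; [apply: hx|apply: hy].
- by apply: pair_powMl; apply: hx.
Qed.

Lemma star_pow_mul m m' x y : star_pow m x -> star_pow m' y -> star_pow (m + m') (x * y).
Proof. by move=> hx hy i j ij; apply: pair_pow_mul; [apply: hx|apply: hy]. Qed.

Lemma star_pow_prod_but i : star_pow 1 (G_ i).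
Proof.
move=> a b ab; apply/pair_pow1P; have [->|ia] := eqVneq i a.
  by rewrite (prod_butE ab) mulrC; apply: in_pairr.
by rewrite (prod_butE ia) mulrC; apply: in_pairl.
Qed.

Lemma star_pow_prod_all : star_pow 2 G.
Proof.
move=> a b ab; rewrite (prod_allE a) (prod_butE ab).
by apply: pair_pow_mulA; rewrite -[F b * _]mulr1 -mulrA; apply: pair_pow_mulB.
Qed.

Lemma star_powX m x i : star_pow m x -> star_pow (m * i) (x ^+ i).
Proof. by move=> hx a b ab; apply/pair_powX/hx. Qed.

Lemma star_pow_gens j0 m : star_gens F j0 m `<=` star_pow m.
Proof.
move=> _ [j [i [jm ->]]].
have e : (2 * j + 1 * (m - j.*2) = m)%N by lia.
rewrite -[X in star_pow X]e.
by apply: star_pow_mul; apply: star_powX; [apply: star_pow_prod_all|apply: star_pow_prod_but].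
Qed.

Lemma star_ideal2E : star_ideal2 F = star_pow 1.
Proof.
apply/seteqP; split=> x hx => [i j ij|[i j] /= ij]; last first.
  by apply/ideal_span2P/pair_pow1P/hx; rewrite neq_ltn ij.
have {}hx (a b : 'I_s) : (a < b)%N -> pair_pow (F a) (F b) 1 x.
  by move=> ab; apply/pair_pow1P/ideal_span2P/(hx (a, b)).
move: ij; rewrite neq_ltn => /orP[/hx//|/hx].
exact: pair_pow_sym.
Qed.

(** In [G = F_a F_b u] the cofactor [u] is regular modulo [(F_a, F_b)], and each of
    [F_a] and [F_b] lowers the exponent by exactly one. *)
Lemma star_pow_cancel m z : star_pow m.+2 (G * z) -> star_pow m z.
Proof.
move=> hz a b ab; have ba : b != a by rewrite eq_sym.
apply: (@pair_pow_cancel _ _ _ (prod_but2 a b)) => //.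
- by apply: regular3_prod => l /andP[la lb]; apply: reg2; rewrite eq_sym.
- by apply: regular3_swap; [apply: reg2|apply: regular_prod_but2].
have [ra rb] : regular2 (F a) (F b) /\ regular2 (F b) (F a) by split; apply: reg2.
apply: (@pair_pow_cancelA _ (F a)) => //; apply: pair_pow_sym.
apply: (@pair_pow_cancelA _ (F b)) => //; apply: pair_pow_sym.
have := hz a b ab; rewrite (prod_allE a) (prod_butE ab); congr pair_pow; ring.
Qed.

Lemma in_all_principal x : (forall i, exists c, x = c * F i) -> exists c, x = c * G.
Proof.
move=> hx; apply/in_pair0; rewrite /prod_all -big_enum.
apply: inter_pairs; first exact: enum_uniq.
- by move=> i j _ _ ij; apply: reg2.
- by move=> i _; apply/in_pair0.
Qed.

(** Modulo [F_i] the condition for the pair [(i, j)] says that [x] is a multiple of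
    [F_j^m], and the [F_j^m] are pairwise regular modulo [F_i]. *)
Lemma star_pow_mod i m x : star_pow m x -> in_pair (F i) (G_ i ^+ m) x.
Proof.
move=> hx; rewrite /prod_but -prodrXl -big_enum.
apply: inter_pairs; first exact: enum_uniq.
- move=> j l; rewrite !mem_enum !unfold_in => ji li jl; apply: regular3_exp.
  apply: regular3_swap; first by apply: reg2; rewrite eq_sym.
  by apply: regular3_exp; apply: reg3; rewrite // eq_sym.
move=> j; rewrite mem_enum unfold_in => ji.
have := hx i j; rewrite eq_sym => /(_ ji).
case: m {hx} => [|m]; first by exists 0, x; ring.
by move=> /pair_pow_normal[y [c [_ ->]]]; exists y, c; ring.
Qed.

(** The same coefficients [c i], one for each congruence modulo [F_i], serve for all
    congruences at once: the other summands vanish modulo [F_i]. *)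
Lemma star_pow_decomp m x : star_pow m.+1 x ->
  exists (c : 'I_s -> R) z, x = \sum_i c i * G_ i ^+ m.+1 + G * z.
Proof.
move=> hx.
have /choice[c hc] : forall i, exists c, exists b, x = b * F i + c * G_ i ^+ m.+1.
  by move=> i; have [b [c e]] := star_pow_mod i hx; exists c, b.
have [|z ez] := @in_all_principal (x - \sum_i c i * G_ i ^+ m.+1).
  move=> i; have [b e] := hc i.
  exists (b - \sum_(l | l != i) c l * G_ l ^+ m * prod_but2 l i).
  rewrite (bigD1 i) //= {1}e opprD addrA addrK mulrBl; congr (_ - _).
  rewrite mulr_suml; apply: eq_bigr => l li.
  by rewrite exprSr {2}(prod_butE li); ring.
by exists c, z; rewrite [G * z]mulrC -ez; ring.
Qed.

Lemma star_pow_span m : star_pow m `<=` ideal_span (star_gens F 0 m).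
Proof.
have gen m' j i : (j <= m'./2)%N ->
    ideal_span (star_gens F 0 m') (G ^+ j * G_ i ^+ (m' - j.*2)).
  by move=> jm; apply: mem_ideal_span; exists j, i.
pose i0 : 'I_s := Ordinal (ltnW (ltnW hs)).
elim/ltn_ind: m => [[|m]] IH x hx.
  rewrite -[x]mulr1; apply: idealM (ideal_span_ideal _) _.
  by have := gen 0%N 0%N i0; rewrite mulr1; apply.
have [c [z ex]] := star_pow_decomp hx.
have hS := ideal_span_ideal (star_gens F 0 m.+1).
have hsum : ideal_span (star_gens F 0 m.+1) (\sum_i c i * G_ i ^+ m.+1).
  apply: ideal_sum => // i _; apply: idealM => //.
  by have := gen m.+1 0%N i; rewrite mul1r; apply.
rewrite ex; apply: idealD => //; case: m IH hx ex hS hsum => [|m] IH hx ex hS hsum.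
  rewrite (_ : G * z = F i0 * z * G_ i0); last by rewrite (prod_allE i0); ring.
  apply: idealM => //.
  by have := gen 1%N 0%N i0; rewrite mul1r; apply.
have hz : star_pow m z.
  apply: (@star_pow_cancel m z); rewrite (_ : G * z = x - \sum_i c i * G_ i ^+ m.+2); last by rewrite ex; ring.
  have hJ := star_pow_ideal m.+2; apply: (idealB hJ) => //.
  apply: (ideal_sum _ hJ) => i _; apply: (idealM _ hJ).
  by have := star_powX m.+2 (star_pow_prod_but i); rewrite mul1n.
have [//|r [d [g [hg ->]]]] := IH m _ z hz.
rewrite mulr_sumr; apply: ideal_sum => // l _; rewrite mulrCA; apply: idealM => //.
have [j [i [jm ->]]] := hg l; rewrite mulrA -exprS.
by rewrite (_ : (m - j.*2 = m.+2 - j.+1.*2)%N); [apply: gen|]; lia.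
Qed.

End StarPow.

(** * Relations between the generators *)

Section Star.
Variables (R : idomainType) (k : fieldType) (ev : {rmorphism R -> k}).
Variables (s : nat) (F : 'I_s -> R).
Hypothesis hs : (2 < s)%N.
Hypothesis F0 : forall i, F i != 0.
Hypothesis reg2 : forall i j, i != j -> regular2 (F i) (F j).
Hypothesis reg3 : forall i j l, i != j -> i != l -> j != l -> regular3 (F i) (F j) (F l).
Hypothesis evF : forall i, ev (F i) = 0.
Notation G := (prod_all F).
Notation G_ := (prod_but F).
Notation J := (star_pow F).
Notation I2 := (star_ideal2 F).

Lemma third_index (a b : 'I_s) : exists l, (l != a) && (l != b).
Proof.
have : (0 < #|~: [set a; b]|)%N.
  by rewrite cardsCs finset.setCK card_ord subn_gt0 (leq_ltn_trans _ hs) // cards2; case: eqP.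
by case/card_gt0P => l; rewrite !inE negb_or => h; exists l.
Qed.

Lemma ev_prod_but2 a b : ev (prod_but2 F a b) = 0.
Proof.
by have [l lab] := third_index a b; rewrite /prod_but2 (bigD1 l) //= rmorphM evF mul0r.
Qed.

Lemma ev_prod_but i : ev (G_ i) = 0.
Proof.
have [l /andP[li _]] := third_index i i.
by rewrite (@prod_butE _ _ F i l) 1?eq_sym // rmorphM evF mul0r.
Qed.

(** Modulo [F_i] the relation reduces to [r_i G_i^(m+1) = 0], and [G_i] is regular
    modulo [F_i]. *)
Lemma syzygy_mod m (r : 'I_s -> R) z :
  \sum_i r i * G_ i ^+ m.+1 + G * z = 0 -> exists q, forall i, r i = q i * F i.
Proof.
move=> e; suff /choice[q hq] : forall i, exists q, r i = q * F i by exists q.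
move=> i.
apply: (@regular2P _ _ (G_ i ^+ m.+1) _ (- (\sum_(l | l != i) r l * G_ l ^+ m * prod_but2 F l i + G_ i * z))).
  exact: (regular_prod_but reg2).
apply/eqP; rewrite -subr_eq0 -[X in _ == X]e [in X in _ == X](bigD1 i) //= mulNr opprK -addrA.
rewrite (prod_allE F i) mulrDl mulr_suml; apply/eqP; congr (_ + (_ + _)); last by ring.
by apply: eq_bigr => l li; rewrite exprSr {3}(prod_butE F li); ring.
Qed.

(** When [m] is even, the generators with [j = m/2] all coincide with [G^(m/2)]; this
    common generator carries the coefficient [t], so that [r] only ranges over
    [2 j < m].  Substituting [r_0i = q_i F_i] turns [r_0i G_i^m] into
    [G q_i G_i^(m-1)]; after division by [G] the relation is one for [m - 2], in
    which [r_1i] has become [r_1i + q_i G_i] (for [m = 2], [t] has gained the sum of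
    the [q_i G_i]). *)
Lemma star_syzygy m (r : 'I_(uphalf m) -> 'I_s -> R) t : (odd m -> t = 0) ->
    \sum_j \sum_i r j i * (G ^+ j * G_ i ^+ (m - j.*2)) + t * G ^+ m./2 = 0 ->
  (forall j i, ev (r j i) = 0) /\ ev t = 0.
Proof.
elim/ltn_ind: m r t => [[|m]] IH r t ht e.
  split; first by case.
  by move: e; rewrite big_ord0 add0r mulr1 => ->; rewrite rmorph0.
have Gn0 : G != 0 by apply: prod_all_neq0.
case: m IH r ht e => [|[|m]] IH r ht e.
- move: e; rewrite ht // mul0r big_ord1.
  under eq_bigr do rewrite /= expr0 mul1r.
  rewrite -[X in _ + X = _](mulr0 G) => /(@syzygy_mod 0)[q hq].
  by split=> [j i|]; rewrite ?ht ?rmorph0 // ord1 hq rmorphM evF mulr0.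
- move: e; rewrite big_ord1.
  under eq_bigr do rewrite /= expr0 mul1r.
  rewrite [t * _]mulrC => e; have [q hq] := @syzygy_mod 1 _ _ e.
  split=> [j i|]; first by rewrite ord1 hq rmorphM evF mulr0.
  suff -> : t = - \sum_i q i * G_ i.
    by rewrite rmorphN rmorph_sum big1 ?oppr0 // => i _; rewrite rmorphM ev_prod_but mulr0.
  apply: (mulfI Gn0); apply/eqP; rewrite -subr_eq0 -[X in _ == X]e mulrN opprK addrC mulr_sumr.
  apply/eqP; congr (_ + _); apply: eq_bigr => i _.
  by rewrite (_ : (2 - 0.*2)%N = 2%N) // hq (prod_allE F i) expr2; ring.
move: e; rewrite (@big_ord_recl _ _ _ (m./2).+1).
under eq_bigr do rewrite expr0 mul1r.
rewrite -addrA; set S := \sum_(i < (m./2).+1) _.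
(* The part of the relation with [1 <= j] is visibly divisible by [G]. *)
have eS : S + t * G ^+ m.+3./2 = G * (\sum_(j < (m./2).+1)
    \sum_i r (lift ord0 j) i * (G ^+ j * G_ i ^+ (m.+1 - j.*2)) + t * G ^+ m.+1./2).
  rewrite mulrDr mulr_sumr; congr (_ + _); last by rewrite [G ^+ _](exprS G m.+1./2); ring.
  apply: eq_bigr => j _; rewrite mulr_sumr; apply: eq_bigr => i _.
  by rewrite /= /bump /= add1n exprS doubleS; ring.
rewrite eS => e; have [q hq] := syzygy_mod e.
pose r' j i := r (lift ord0 j) i + q i * G_ i *+ (j == ord0).
have [|||hr' ->] := IH m.+1 _ r' t.
- by rewrite ltnS leqnSn.
- by move=> om; apply: ht; rewrite /= negbK.
- apply: (mulfI Gn0); rewrite mulr0 -[RHS]e.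
  rewrite !mulrDr addrA; congr (_ + _); rewrite [in LHS]big_ord_recl [X in _ = _ + G * X]big_ord_recl.
  rewrite !mulrDr addrA; congr (_ + _).
    rewrite !mulr_sumr -big_split; apply: eq_bigr => i _.
    by rewrite /r' hq (prod_allE F i) /= expr0 subn0 (exprS _ m.+2) (exprS _ m.+1); ring.
  by congr (_ * _); apply: eq_bigr => j _; apply: eq_bigr => i _; rewrite /r' /= mulr0n addr0.
split=> // j i; have [->|[j' ->]] : j = ord0 \/ exists j', j = lift ord0 j'.
  by case: (unliftP ord0 j) => [j' ->|->]; [right; exists j'|left].
  by rewrite hq rmorphM evF mulr0.
by have := hr' j' i; rewrite /r' rmorphD rmorphMn rmorphM ev_prod_but mulr0 mul0rn addr0.
Qed.

(** Indexes each generator once: the pairs [(j, i)] with [p] successive values of [j],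
    and, exactly when [m] is even, one more index for [G^(m/2)]. *)
Definition star_index (p m : nat) : finType := ('I_p * 'I_s + 'I_(~~ odd m))%type.

Definition star_family (j0 p m : nat) (x : star_index p m) : R :=
  match x with
  | inl (j, i) => G ^+ (j0 + j) * G_ i ^+ (m - (j0 + j).*2)
  | inr _ => G ^+ m./2
  end.

Lemma card_star_index p m : #|star_index p m| = (p * s + ~~ odd m)%N.
Proof. by rewrite card_sum card_prod !card_ord. Qed.

Lemma star_gens_range j0 p m : (0 < m)%N -> (j0 <= 1)%N -> (j0 + p)%N = uphalf m ->
  star_gens F j0 m = range (@star_family j0 p m).
Proof.
move=> m0 hj0 e; have := odd_double_half m; have := uphalf_half m => um om.
pose i0 : 'I_s := Ordinal (ltnW (ltnW hs)).
apply/seteqP; split=> x /=.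
  move=> [j [i [/andP[lj uj] ->]]].
  have [jm|jm] := ltnP j (uphalf m).
    have hp : (j - j0 < p)%N by lia.
    by exists (inl (Ordinal hp, i)) => //=; rewrite subnKC.
  have o : (0 < ~~ odd m)%N by lia.
  exists (inr (Ordinal o)) => //=.
  have -> : j = m./2 by lia.
  by rewrite (_ : (m - m./2.*2 = 0)%N) ?mulr1 //; lia.
move=> [[[j i]|l] _ <-] /=.
  by exists (j0 + j)%N, i; split=> //; have := ltn_ord j; lia.
have ol := ltn_ord l; exists m./2, i0; split; first by move: ol; lia.
by rewrite (_ : (m - m./2.*2 = 0)%N) ?mulr1 //; move: ol; lia.
Qed.

Lemma star_sumE j0 p m (c : star_index p m -> R) :
  \sum_x c x * star_family j0 x =
  \sum_j \sum_i c (inl (j, i)) * (G ^+ (j0 + j) * G_ i ^+ (m - (j0 + j).*2))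
  + (\sum_l c (inr l)) * G ^+ m./2.
Proof.
rewrite big_sumType /= pair_bigA /= mulr_suml; congr (_ + _).
by apply: eq_bigr => [[j i]].
Qed.

Lemma star_family_free m (c : star_index (uphalf m) m -> R) :
  \sum_x c x * star_family 0 x = 0 -> forall x, ev (c x) = 0.
Proof.
have sum1 b (f : 'I_(~~ b) -> R) l : f l = \sum_l f l.
  by case: b f l => f l; [case: l|rewrite big_ord1 ord1].
rewrite star_sumE => /star_syzygy[|h1 h2 [[j i]|l]]; last 2 first.
- exact: h1.
- by rewrite -h2 -(sum1 _ (fun l => c (inr l)) l).
move=> om; apply: big1 => l _; have := ltn_ord l.
by rewrite [X in (_ < X)%N](_ : _ = 0%N) // om.
Qed.

(** The product of the kernel of [ev] with the [m]-th symbolic power, written on the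
    generators so that the coefficients can be compared. *)
Definition ker_star_pow m : set R := [set x | exists e : star_index (uphalf m) m -> R,
  (forall y, ev (e y) = 0) /\ x = \sum_y e y * star_family 0 y].

Lemma ker_star_pow_ideal m : is_ideal (ker_star_pow m).
Proof.
split.
- exists (fun=> 0); split=> [y|]; first by rewrite rmorph0.
  by rewrite big1 // => y _; rewrite mul0r.
- move=> x y [e [he ->]] [e' [he' ->]]; exists (fun y => e y + e' y); split.
    by move=> z; rewrite rmorphD he he' addr0.
  by rewrite -big_split; apply: eq_bigr => z _; rewrite mulrDl.
- move=> a x [e [he ->]]; exists (fun y => a * e y); split.
    by move=> z; rewrite rmorphM he mulr0.
  by rewrite mulr_sumr; apply: eq_bigr => z _; rewrite mulrA.
Qed.

Lemma ker_star_pow_mul m a y : (0 < m)%N -> ev a = 0 -> J m y -> ker_star_pow m (a * y).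
Proof.
move=> m0 ha /(star_pow_span hs F0 reg2 reg3).
rewrite (@star_gens_range 0 (uphalf m)) // => /ideal_spanP[c ->].
exists (fun y => a * c y); split=> [z|]; first by rewrite rmorphM ha mul0r.
by rewrite mulr_sumr; apply: eq_bigr => z _; rewrite mulrA.
Qed.

(** The ideal spanned by the [G_i^m], up to the kernel of [ev] times the [m]-th
    symbolic power. *)
Definition powers_mod m : set R :=
  [set x | exists (d : 'I_s -> R) w, ker_star_pow m w /\ x = \sum_i d i * G_ i ^+ m + w].

Lemma powers_mod_ideal m : is_ideal (powers_mod m).
Proof.
have hK := ker_star_pow_ideal m; split.
- exists (fun=> 0), 0; split; first by case: hK.
  by rewrite big1 ?addr0 // => i _; rewrite mul0r.
- move=> x y [d [w [hw ->]]] [d' [w' [hw' ->]]].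
  exists (fun i => d i + d' i), (w + w'); split; first exact: idealD.
  by rewrite addrACA -big_split; congr (_ + _); apply: eq_bigr => i _; rewrite mulrDl.
- move=> a x [d [w [hw ->]]]; exists (fun i => a * d i), (a * w); split; first exact: idealM.
  by rewrite mulrDr mulr_sumr; congr (_ + _); apply: eq_bigr => i _; rewrite mulrA.
Qed.

Lemma powers_modX m i : powers_mod m (G_ i ^+ m).
Proof.
exists (fun l => (l == i)%:R), 0; split; first by case: (ker_star_pow_ideal m).
by rewrite addr0 (bigD1 i) //= eqxx mul1r big1 ?addr0 // => l /negPf->; rewrite mul0r.
Qed.

(** In [G_i G_l^(m+1)] with [l != i], the factor [G_i G_l] is [G] times a product of
    the [s - 2 > 0] remaining forms, and this product is killed by [ev]. *)
Lemma powers_mod_step m i x : powers_mod m.+1 x -> powers_mod m.+2 (G_ i * x).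
Proof.
move=> [d [_ [[e [he ->]] ->]]].
have hP := powers_mod_ideal m.+2.
have kP y : ker_star_pow m.+2 y -> powers_mod m.+2 y.
  by move=> hy; exists (fun=> 0), y; split=> //; rewrite big1 ?add0r // => l _; rewrite mul0r.
rewrite mulrDr !mulr_sumr; apply: idealD => //; apply: ideal_sum => // l _.
  rewrite mulrCA; apply: idealM => //; have [->|li] := eqVneq l i.
    by rewrite -exprS; apply: powers_modX.
  rewrite exprS mulrA mulrC [G_ i * _]mulrC prod_butM // mulrC -mulrA.
  apply/kP/ker_star_pow_mul => //; first exact: ev_prod_but2.
  rewrite -(addn2 m) addnC; apply: star_pow_mul; first exact: star_pow_prod_all.
  by have := star_powX m (star_pow_prod_but F l); rewrite mul1n.
rewrite mulrCA; apply/kP/ker_star_pow_mul => //; rewrite -(add1n m.+1).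
apply: star_pow_mul; first exact: star_pow_prod_but.
have : star_gens F 0 m.+1 (star_family 0 l) by rewrite (@star_gens_range 0 (uphalf m.+1)).
exact: star_pow_gens.
Qed.

Lemma prod_but_span y : I2 y -> exists c : 'I_s -> R, y = \sum_i c i * G_ i.
Proof.
rewrite star_ideal2E => /(star_pow_span hs F0 reg2 reg3) h.
apply/(ideal_spanP G_); apply: ideal_span_sub h => _ [j [i [jm ->]]].
have -> : j = 0%N by case: j jm.
by exists i => //; rewrite mul1r.
Qed.

(** The ordinary power contributes to the symbolic power only the generators
    [G_i^m], up to terms that do not count for minimal generation. *)
Lemma ideal_pow_sub m : (0 < m)%N -> ideal_pow I2 m `<=` powers_mod m.
Proof.
move=> m0; apply: ideal_span_min; first exact: powers_mod_ideal.
case: m m0 => // m _ _ [a [ha ->]]; elim: m a ha => [|m IH] a ha.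
  rewrite big_ord1; have [c ->] := prod_but_span (ha ord0).
  have hP := powers_mod_ideal 1; apply: ideal_sum => // i _; apply: idealM => //.
  exact: (powers_modX 1).
rewrite big_ord_recl; have [c ->] := prod_but_span (ha ord0).
have hP := powers_mod_ideal m.+2; rewrite mulr_suml.
apply: ideal_sum => // i _; rewrite -mulrA; apply: idealM => //.
by apply: powers_mod_step; apply: IH.
Qed.

(** An element of [I^(m+1)] written on the generators with [1 <= j] yields, through
    [ideal_pow_sub], a relation among all the generators of the symbolic power; its
    coefficients at [1 <= j] differ from the given ones by elements killed by
    [ev]. *)
Lemma star_family_free_mod m (c : star_index m./2 m.+1 -> R) :
  ideal_pow I2 m.+1 (\sum_x c x * star_family 1 x) -> forall x, ev (c x) = 0.
Proof.
move=> /ideal_pow_sub[//|d [w [[e [he ->]] E]]].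
(* The index [j = 0] carries the [G_i^(m+1)] that come from the ordinary power. *)
pose c' (x : star_index (uphalf m.+1) m.+1) : R :=
  match x with
  | inl (j, i) => if unlift ord0 j is Some j' then c (inl (j', i)) else - d i
  | inr l => c (inr l)
  end - e x.
have h : \sum_x c' x * star_family 0 x = 0.
  under eq_bigr do rewrite mulrBl.
  rewrite sumrB star_sumE big_ord_recl.
  move: E; rewrite star_sumE => E; apply/eqP; rewrite subr_eq0.
  rewrite [X in X + _ + _](_ : _ = - \sum_i d i * G_ i ^+ m.+1); last first.
    by rewrite -sumrN; apply: eq_bigr => i _; rewrite unlift_none mulNr mul1r.
  rewrite -addrA addrC subr_eq [eqbRHS]addrC -E; apply/eqP; congr (_ + _).
  apply: eq_bigr => j _; apply: eq_bigr => i _.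
  by rewrite liftK.
have /star_family_free h' := h.
have hc x : ev (c' x) = 0 -> ev (c' x + e x) = 0 by move=> hx; rewrite rmorphD hx he addr0.
case=> [[j i]|l].
  by have := hc _ (h' (inl (lift ord0 j, i))); rewrite /c' subrK liftK.
by have := hc _ (h' (inr l)); rewrite /c' subrK.
Qed.

End Star.

(** * Minimal generation of a quotient of ideals *)

Section MinimalGenerators.
Variables (R : idomainType) (k : fieldType) (ev : {rmorphism R -> k}).
Variables (N M : set R) (K : finType) (g : K -> R).
Hypotheses (hM : is_ideal M) (hg : generates N M (range g)).
Hypothesis g_free : forall c : K -> R, M (\sum_x c x * g x) -> forall x, ev (c x) = 0.

(** This is how independence gets used: modulo [M], no expression of [g x0] can do
    without [g x0]. *)
Lemma free_not_mod (c : K -> R) x0 : M (g x0 - \sum_x c x * g x) -> ev (c x0) = 1.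
Proof.
move=> h; have := @g_free (fun x => (x == x0)%:R - c x).
have -> : \sum_x ((x == x0)%:R - c x) * g x = g x0 - \sum_x c x * g x.
  under eq_bigr do rewrite mulrBl.
  rewrite sumrB; congr (_ - _); rewrite (bigD1 x0) //= eqxx mul1r big1 ?addr0 //.
  by move=> x /negPf->; rewrite mul0r.
by move=> /(_ h x0); rewrite eqxx rmorphB rmorph1 => /eqP; rewrite subr_eq0 => /eqP.
Qed.

Lemma free_injective : injective g.
Proof.
move=> x y e; apply/eqP; apply: contraT => xy.
have := @free_not_mod (fun z => (z == y)%:R) x.
rewrite (bigD1 y) //= eqxx mul1r big1 ?addr0; last by move=> z /negPf->; rewrite mul0r.
rewrite e subrr (negPf xy) rmorph0 => /(_ _)/eqP; rewrite eq_sym oner_eq0 => h.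
by have : false by apply: h; case: hM.
Qed.

Lemma free_minimal : minimal_generating_set N M (range g).
Proof.
split=> // T [Tg nTg] [_ hT].
have [_ [[x0 _ <-] nT]] : exists y, range g y /\ ~ T y.
  by apply: contrapT => h; apply: nTg => y gy; apply: contrapT => nT; apply: h; exists y.
have [y Ty] := hT (g x0) (hg.1 _ (ex_intro2 _ _ x0 I erefl)).
suff [c [c0 ->]] : exists c : K -> R, c x0 = 0 /\ y = \sum_x c x * g x.
  by move=> /free_not_mod/eqP; rewrite c0 rmorph0 eq_sym oner_eq0.
(* The ideal generated by the members of the family other than [g x0]. *)
pose L := [set y | exists c : K -> R, c x0 = 0 /\ y = \sum_x c x * g x].
apply: (@ideal_span_min _ L T) Ty => [|z Tz].
  split.
  - by exists (fun=> 0); split=> //; rewrite big1 // => x _; rewrite mul0r.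
  - move=> u v [c [c0 ->]] [d [d0 ->]]; exists (fun x => c x + d x).
    split; first by rewrite c0 d0 addr0.
    by rewrite -big_split; apply: eq_bigr => x _; rewrite mulrDl.
  - move=> a u [c [c0 ->]]; exists (fun x => a * c x); split; first by rewrite c0 mulr0.
    by rewrite mulr_sumr; apply: eq_bigr => x _; rewrite mulrA.
have [x _ ex] := Tg z Tz; exists (fun x' => (x' == x)%:R); split.
  by case: eqP => // xx; case: nT; rewrite xx ex.
rewrite (bigD1 x) //= eqxx mul1r big1 ?addr0 //.
by move=> x' /negPf->; rewrite mul0r.
Qed.

(** A generating set of [r] elements factors the identity of the residue vector space
    of dimension [#|K|] through dimension [r]: the matrices that express the two
    generating families in terms of each other have product [1] after [ev]. *)
Lemma free_mu : mu_eq N M #|K|.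
Proof.
split.
  exists (range g); split=> //.
  apply: (card_eq_trans (inj_card_eq (in2W free_injective))).
  apply/card_set_bijP; exists (fun x => enum_rank x : nat); split.
  - by move=> x _ /=.
  - by move=> x y _ _ /val_inj/enum_rank_inj.
  - by move=> i /= hi; exists (enum_val (Ordinal hi)) => //; rewrite enum_valK.
move=> S r [SN hS] /card_set_bijP[f [fS finj fsurj]].
have /choice[h hf] : forall i : 'I_r, exists y, S y /\ f y = i.
  by move=> i; have [y] := fsurj i (ltn_ord i); exists y.
have hr : S = range h.
  apply/seteqP; split=> [y Sy|_ [i _ <-]]; last by case: (hf i).
  exists (Ordinal (fS y Sy)) => //; have [Sh eh] := hf (Ordinal (fS y Sy)).
  by apply: finj; rewrite ?inE.
have /choice[a ha] : forall x, exists a : 'I_r -> R, M (g x - \sum_i a i * h i).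
  move=> x; have [y] := hS (g x) (hg.1 _ (ex_intro2 _ _ x I erefl)).
  by rewrite hr => /ideal_spanP[a ->]; exists a.
have /choice[b hb] : forall i, exists b : K -> R, M (h i - \sum_x b x * g x).
  move=> i; have [y] := hg.2 (h i) (SN _ (hf i).1).
  by move=> /ideal_spanP[b ->]; exists b.
(* The product of the two matrices is determined by independence. *)
have hab x y : ev (\sum_i a x i * b i y) = (x == y)%:R.
  have := @g_free (fun z => (x == z)%:R - \sum_i a x i * b i z).
  have -> : \sum_z ((x == z)%:R - \sum_i a x i * b i z) * g z =
      (g x - \sum_i a x i * h i) + \sum_i a x i * (h i - \sum_z b i z * g z).
    under eq_bigr do rewrite mulrBl.
    rewrite sumrB (bigD1 x) //= eqxx mul1r big1 ?addr0; last first.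
      by move=> z; rewrite eq_sym => /negPf->; rewrite mul0r.
    under [X in _ = _ + X]eq_bigr do rewrite mulrBr mulr_sumr.
    rewrite sumrB addrA subrK exchange_big /=; congr (_ - _).
    apply: eq_bigr => z _; rewrite mulr_suml; apply: eq_bigr => i _.
    by rewrite mulrA.
  have hs : M (g x - \sum_i a x i * h i + \sum_i a x i * (h i - \sum_z b i z * g z)).
    by apply: idealD => //; apply: ideal_sum => // i _; apply: idealM.
  by move=> /(_ hs y); rewrite rmorphB rmorph_nat => /eqP; rewrite subr_eq0 => /eqP.
pose A := \matrix_(i < #|K|, j < r) ev (a (enum_val i) j).
pose B := \matrix_(j < r, i < #|K|) ev (b j (enum_val i)).
apply: (@mulmx1_min k _ _ A B); apply/matrixP => i j.
rewrite !mxE -(inj_eq enum_val_inj) -hab rmorph_sum.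
by apply: eq_bigr => l _; rewrite !mxE rmorphM.
Qed.

End MinimalGenerators.

(** * Associated primes and localization *)

Section Localization.
Variable R : idomainType.
Implicit Types (I J P Q : set R).

(** Clearing denominators: the product of the finitely many denominators stays
    outside [P] because [P] is prime. *)
Lemma extensionP J P x : is_ideal J -> prime_ideal P ->
  extension J P (tofrac x) <-> exists2 b, ~ P b & J (b * x).
Proof.
move=> hJ [[P0 PD PM] P1 Pprime].
have ne0 b : ~ P b -> tofrac b != 0 by rewrite tofrac_eq0; apply: contra_notN => /eqP->.
split=> [[r [c [g [hcg e]]]]|[b nb Jbx]]; last first.
  exists 1%N, (fun=> tofrac 1 / tofrac b), (fun=> b * x); split.
    by move=> _; split=> //; exists 1, b.
  by rewrite big_ord1 tofracM tofrac1 mul1r mulKf // ne0.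
have /choice[a /choice[b hab]] : forall i, exists a b, ~ P b /\ c i = tofrac a / tofrac b.
  by move=> i; case: (hcg i) => + _; case=> a [b h]; exists a, b.
exists (\prod_i b i).
  elim/big_ind: _ => // [u v nu nv /Pprime[]//|i _]; by case: (hab i).
suff -> : (\prod_i b i) * x = \sum_i a i * (\prod_(j | j != i) b j) * g i.
  by apply: ideal_sum => // i _; apply: idealM => //; case: (hcg i).
apply/eqP; rewrite -tofrac_eq tofracM e mulr_sumr rmorph_sum; apply/eqP.
apply: eq_bigr => i _; case: (hab i) => nb ->.
rewrite (bigD1 i) //= !tofracM; have := ne0 _ nb; move: (tofrac (b i)) => u u0.
by field.
Qed.

Definition noetherian := forall I : nat -> set R, (forall n, is_ideal (I n)) ->
  (forall n, I n `<=` I n.+1) -> exists n, I n.+1 `<=` I n.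

(** A colon ideal [(Q : f g)] that is maximal among the proper ones is prime; without
    such a maximum, the successive multipliers would give a strictly ascending chain
    of ideals. *)
Lemma prime_colon Q g : noetherian -> is_ideal Q -> ~ Q g ->
  exists f, prime_ideal [set x | Q (x * (f * g))].
Proof.
move=> noeth hQ ng; pose col w := [set x | Q (x * w)].
have colI w : is_ideal (col w).
  split=> [|x y|a x]; rewrite /col /=; first by rewrite mul0r; case: hQ.
    by rewrite mulrDl; apply: idealD.
  by rewrite -mulrA; apply: idealM.
have colM a w : col w `<=` col (a * w) by move=> x hx; rewrite /col /= mulrCA; apply: idealM.
have [f nf fmax] : exists2 f, ~ Q (f * g) &
    forall h, ~ Q (h * (f * g)) -> col (h * (f * g)) `<=` col (f * g).
  apply: contrapT => hno.
  have /choice[st hst] : forall f, exists h, ~ Q (f * g) ->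
      ~ Q (h * (f * g)) /\ ~ (col (h * (f * g)) `<=` col (f * g)).
    move=> f; have [nf|?] := pselect (~ Q (f * g)); last by exists 0.
    apply: contrapT => hn; apply: hno; exists f => // h nh.
    by apply: contrapT => nc; apply: hn; exists h.
  (* [w n] is the product of the successive multipliers. *)
  pose w := fix w n := if n is n'.+1 then st (w n') * w n' else 1.
  have nw n : ~ Q (w n * g).
    elim: n => [|n /hst[]] /=; first by rewrite mul1r.
    by rewrite mulrA.
  have [||n] := noeth (fun n => col (w n * g)); first by move=> n; apply: colI.
    by move=> n /=; rewrite -mulrA; apply: colM.
  by have [_] := hst _ (nw n); rewrite /= -mulrA.
exists f; split; first exact: colI.
  by rewrite /= mul1r.
move=> x y /= hxy; have [hy|ny] := pselect (Q (y * (f * g))); first by right.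
by left; apply: (fmax y ny); rewrite /col /= mulrA.
Qed.

End Localization.

(** * The symbolic powers of the star ideal *)

Section Symbolic.
Variables (R : idomainType) (s : nat) (F : 'I_s -> R).
Hypothesis F0 : forall i, F i != 0.
Hypothesis reg2 : forall i j, i != j -> regular2 (F i) (F j).
Hypothesis reg3 : forall i j l, i != j -> i != l -> j != l -> regular3 (F i) (F j) (F l).
Hypothesis noeth : noetherian R.
Notation I2 := (star_ideal2 F).

(** The product [u] of the forms other than [F_a] and [F_b] lies in every
    [(F_i, F_j)] with [{i, j} != {a, b}] and is regular modulo [(F_a, F_b)], so
    [(I : u w) = ((F_a, F_b) : w)]. *)
Lemma pair_colon_assoc a b w : a != b ->
  prime_ideal [set x | pair_pow (F a) (F b) 1 (x * w)] ->
  assoc_primes I2 [set x | pair_pow (F a) (F b) 1 (x * w)].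
Proof.
move=> ab hP; split=> //; exists (prod_but2 F a b * w).
apply/seteqP; split=> x /=; rewrite star_ideal2E => hx; last first.
  have /pair_pow1P := hx a b ab; rewrite mulrCA mulrC => /(regular_prod_but2 reg3 ab).
  by move=> h; apply/pair_pow1P.
have hl i j l : (l != a) && (l != b) -> l = i \/ l = j ->
    pair_pow (F i) (F j) 1 (x * (prod_but2 F a b * w)).
  move=> lab hl; apply/pair_pow1P; rewrite /prod_but2 (bigD1 l) //= mulrCA.
  rewrite -mulrA mulrC; case: hl => <-; first exact: in_pairl.
  exact: in_pairr.
move=> i j ij; have [iab|] := boolP ((i != a) && (i != b)).
  by apply: (hl i j i) => //; left.
have [jab _|] := boolP ((j != a) && (j != b)); first by apply: (hl i j j) => //; right.
have hx' : pair_pow (F a) (F b) 1 (x * (prod_but2 F a b * w)).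
  by rewrite mulrCA; apply: pair_powMl.
rewrite !negb_and !negbK => /orP[]/eqP ej /orP[]/eqP ei; rewrite ei ej //; rewrite ei ej ?eqxx // in ij *.
exact: pair_pow_sym.
Qed.

Lemma star_ideal2_pow m : ideal_pow I2 m `<=` star_pow F m.
Proof.
apply: ideal_span_min; first exact: star_pow_ideal.
move=> _ [a [ha ->]]; elim: m a ha => [|m IH] a ha; first by [].
rewrite big_ord_recl; apply: (@star_pow_mul _ _ F 1 m); last exact: IH.
by have := ha ord0; rewrite star_ideal2E.
Qed.

(** If [x] were outside [(F_a, F_b)^m], the prime colon ideal built from
    [pair_pow_witness] would be an associated prime at which [x] is not in the
    extension of [I^m]. *)
Lemma symbolic_power_sub m : symbolic_power I2 m `<=` star_pow F m.
Proof.
move=> x hx a b ab; apply: contrapT => nx.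
have [g ng hg] := pair_pow_witness (F0 a) (reg2 ab) nx.
have [f hP] := prime_colon noeth (pair_pow_ideal _ _ _) ng.
have := hx _ (pair_colon_assoc ab hP); rewrite /=.
move=> /(extensionP _ (ideal_span_ideal _) hP)[c nc hc]; apply: nc; rewrite /mkset.
by rewrite mulrCA; apply: pair_powMl; apply: hg; apply: (star_ideal2_pow hc).
Qed.

(** Take [(F_a, F_b)] not containing the [f] with [P = (I : f)]: every other form is
    regular modulo it, hence cannot multiply [f] into it. *)
Lemma assoc_prime_pair P : assoc_primes I2 P -> exists a b,
  a != b /\ ~ P (prod_but2 F a b).
Proof.
move=> [[hPi P1 Pprime] [f eP]].
have [a [b [ab nf]]] : exists a b, a != b /\ ~ pair_pow (F a) (F b) 1 f.
  apply: contrapT => h; apply: P1; rewrite eP /= mul1r star_ideal2E => a b ab.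
  by apply: contrapT => nf; apply: h; exists a, b.
exists a, b; split=> //; rewrite eP /= star_ideal2E => /(_ a b ab)/pair_pow1P.
by rewrite mulrC => /(regular_prod_but2 reg3 ab)/pair_pow1P.
Qed.

(** With [u] the product of the forms other than [F_a] and [F_b], both [u F_a = G_b]
    and [u F_b = G_a] lie in [I], so [u^m] multiplies [(F_a, F_b)^m] into [I^m]. *)
Lemma star_pow_symbolic m : star_pow F m `<=` symbolic_power I2 m.
Proof.
move=> x hx P hP /=; have [a [b [ab nP]]] := assoc_prime_pair hP.
have [[hPi P1 Pprime] _] := hP.
apply/(extensionP _ (ideal_span_ideal _)); first by case: hP.
exists (prod_but2 F a b ^+ m).
  by elim: m {hx} => [|m IH] //; rewrite exprS => /Pprime[].
have I2G i : I2 (prod_but F i) by rewrite star_ideal2E; apply: star_pow_prod_but.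
have {hx} := hx a b ab; elim: m x => [|m IH] x.
  by move=> _; apply: ideal_pow0.
move=> [y [z [/IH hy /IH hz ->]]].
rewrite exprS (_ : _ * _ = prod_but F b * (prod_but2 F a b ^+ m * y)
   + prod_but F a * (prod_but2 F a b ^+ m * z)).
  by apply: idealD; [exact: ideal_pow_ideal|apply: ideal_pow_mul|apply: ideal_pow_mul].
rewrite (prod_butE F ab) (@prod_butE _ _ F b a) 1?eq_sym // (prod_but2_sym F b a); ring.
Qed.

Lemma symbolic_powerE m : symbolic_power I2 m = star_pow F m.
Proof. by apply/seteqP; split; [apply: symbolic_power_sub|apply: star_pow_symbolic]. Qed.

End Symbolic.

(** * Polynomial rings are Noetherian *)

(** One coordinate at a time: always moving to a later index at which the coordinate
    is smallest among all later indices makes it nondecreasing. *)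
Lemma monotone_subseq (I : eqType) (u : nat -> I -> nat) (l : seq I) :
  exists phi : nat -> nat, {homo phi : i j / (i < j)%N} /\
    forall c, c \in l -> {homo (fun i => u (phi i) c) : i j / (i <= j)%N}.
Proof.
elim: l => [|c l [phi [phi_lt phi_le]]]; first by exists id; split.
pose v i := u (phi i) c.
have /choice[nxt hnxt] : forall i, exists j, (i < j)%N /\ forall j', (i < j')%N -> (v j <= v j')%N.
  move=> i; have ex : exists x, `[< exists j, (i < j)%N /\ v j = x >].
    by exists (v i.+1); apply/asboolP; exists i.+1.
  case: (ex_minnP ex) => _ /asboolP[j [ij <-]] hmin; exists j; split=> // j' ij'.
  by apply: hmin; apply/asboolP; exists j'.
(* The values of [psi] are themselves values of [nxt], so each of them minimizes
   [v] over a range that contains all the later ones. *)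
pose psi := fix psi i := nxt (if i is i'.+1 then psi i' else 0%N).
have psiS i : (psi i < psi i.+1)%N by case: (hnxt (psi i)).
have psi_lt : {homo psi : i j / (i < j)%N} by apply: homo_ltn => //; apply: ltn_trans.
exists (phi \o psi); split; first by move=> i j /psi_lt/phi_lt.
move=> d; rewrite inE => /orP[/eqP->|dl]; last first.
  by move=> i j ij; apply: phi_le => //; move: ij; rewrite leq_eqVlt => /orP[/eqP->//|/psi_lt/ltnW].
apply: homo_leq => // [|i]; first exact: leq_trans.
rewrite -/(v _) -/(v (psi i.+1)); case: i => [|i] /=.
  have [_] := hnxt 0%N; apply; apply: ltn_trans (psiS 0%N); by case: (hnxt 0%N).
have [_] := hnxt (psi i); apply; exact: (ltn_trans (psiS i) (psiS i.+1)).
Qed.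

Lemma dickson n (u : nat -> 'X_{1..n}) : exists i j, (i < j)%N /\ (u i <= u j)%MM.
Proof.
have [phi [phi_lt phi_le]] := monotone_subseq (fun i c => u i c) (enum 'I_n).
exists (phi 0%N), (phi 1%N); split; first exact: phi_lt.
by apply/mnm_lepP => c; apply: phi_le => //; rewrite mem_enum.
Qed.

Lemma exists_min_mlead (k : fieldType) n (D : set {mpoly k[n]}) p : D p ->
  exists2 q, D q & forall r, D r -> ~ (mlead r < mlead q)%O.
Proof.
move: {2}(mlead p) (erefl (mlead p)) => m; move: m p.
elim/(well_founded_ind (@ltom_wf n)) => m IH p ep Dp.
have [[r [Dr rp]]|h] := pselect (exists r, D r /\ (mlead r < mlead p)%O).
  by apply: (IH (mlead r) _ r) => //; rewrite -ep.
by exists p => // r Dr rp; apply: h; exists r.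
Qed.

(** In a strictly ascending chain, choose in each step a new element with the smallest
    leading monomial.  By the lemma of Dickson the leading monomial of one choice
    divides that of a later choice; cancelling the leading terms produces a new
    element with a smaller leading monomial. *)
Lemma mpoly_noetherian (k : fieldType) n : noetherian {mpoly k[n]}.
Proof.
move=> I hI Iinc; apply: contrapT => hno.
have /choice[p hp] : forall i, exists p, (I i.+1 p /\ ~ I i p) /\
    forall r, I i.+1 r /\ ~ I i r -> ~ (mlead r < mlead p)%O.
  move=> i; have [p0 hp0] : exists p, I i.+1 p /\ ~ I i p.
    apply: contrapT => h; apply: hno; exists i => p hp; apply: contrapT => np.
    by apply: h; exists p.
  by have [p] := exists_min_mlead (D := [set p | I i.+1 p /\ ~ I i p]) hp0; exists p.
have Ile i j : (i <= j)%N -> I i `<=` I j.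
  elim: j => [|j IH]; first by rewrite leqn0 => /eqP->.
  rewrite leq_eqVlt => /orP[/eqP->//|]; rewrite ltnS => /IH h x /h; exact: Iinc.
have [i [j [ij]]] := dickson (fun i => mlead (p i)).
have [[Ipi nIpi] _] := hp i; have [[Ipj nIpj] minj] := hp j.
have p0 l : p l != 0.
  by apply: contra_notN (hp l).1.2 => /eqP->; case: (hI l).
move=> hle; pose c := (p j)@_(mlead (p j)) / (p i)@_(mlead (p i)).
pose m := (mlead (p j) - mlead (p i))%MM; pose r := c *: (p i * 'X_[m]).
have em : (m + mlead (p i))%MM = mlead (p j) by rewrite submK.
have c0 : c != 0 by rewrite mulf_neq0 ?invr_eq0 ?mleadc_eq0.
have lr : mlead r = mlead (p j).
  have X0 : 'X_[m] != 0 :> {mpoly k[n]} by rewrite -msupp_eq0 msuppX.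
  by rewrite mleadZ // mleadM // mleadXm addmC em.
have Ir : I j r.
  by rewrite /r -mul_mpolyC mulrCA mulrC; apply: idealM => //; apply: (Ile i.+1).
have nq : ~ I j (p j - r).
  by move=> h; apply: nIpj; rewrite -(subrK r (p j)); apply: idealD.
apply: (minj (p j - r)).
  split=> //; apply: idealB => //; exact: Iinc.
rewrite lt_neqAle -[X in (_ <= X)%O]joinxx -{3}lr mleadB_le andbT.
apply/negP => /eqP e; have : p j - r == 0.
  rewrite -mleadc_eq0 e mcoeffB mcoeffZ -{2}em mcoeffMX divfK ?subrr //.
  by rewrite mleadc_eq0.
by move=> /eqP e0; apply: nq; rewrite e0; case: (hI j).
Qed.

(** * Star configurations of hypersurfaces *)

Section RegularSequence.
Variable R : idomainType.
Implicit Types A B C : R.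

Lemma regular_seq3P A B C : regular_sequence [:: A; B; C] ->
  [/\ A != 0, regular2 A B, regular3 A B C & ~ ideal_span [set` [:: A; B; C]] 1].
Proof.
move=> [reg n1]; split=> //.
- apply/eqP => A0; have := reg 0%N isT 1; rewrite /= A0 mulr0.
  have h0 := ideal_span_ideal [set` [::] : seq R]; case: (h0) => z _ _ /(_ z).
  move=> [[|r] [c [g [hg]]]]; last by have := hg ord0.
  by rewrite big_ord0 => /eqP; rewrite oner_eq0.
- move=> a /in_pair0[b e]; apply/in_pair0.
  have h1 x : ideal_span [set` [:: A]] x <-> exists c, x = c * A.
    have -> : [set` [:: A]] = [set A; A].
      by apply/seteqP; split=> y /=; rewrite inE; [move=> /eqP->; left|case=> ->].
    split=> [/ideal_span2P[c [d ->]]|[c ->]]; first by exists (c + d); ring.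
    by apply/ideal_span2P; exists c, 0; ring.
  by apply/h1/(reg 1%N isT)/h1; exists b.
- have h2 x : ideal_span [set` [:: A; B]] x <-> in_pair A B x.
    rewrite -ideal_span2P; have -> // : [set` [:: A; B]] = [set A; B].
    apply/seteqP; split=> y /=; rewrite !inE; last by case=> ->; rewrite eqxx ?orbT.
    by case/orP => /eqP->; [left|right].
  by move=> a ha; apply/h2/(reg 2%N isT)/h2.
Qed.

End RegularSequence.

(** A form with a nonzero constant coefficient has degree zero, hence is a nonzero
    constant. *)
Lemma homog_mcoeff0 (k : fieldType) n d (p : {mpoly k[n]}) :
  p \is d.-homog for mdeg -> p@_0%MM != 0 -> exists q, q * p = 1.
Proof.
move=> hp p0; have d0 : d = 0%N.
  by apply/eqP; apply: contra_neqT p0 => dn; apply: (dhomog_nemf_coeff hp); rewrite mf0 eq_sym.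
have -> : p = (p@_0%MM)%:MP.
  apply: msize1_polyC; rewrite msizeE; apply/bigmax_leqP_seq => m mp _.
  by rewrite (dhomog_mf hp) // d0.
by exists (p@_0%MM)^-1%:MP; rewrite -mpolyCM mulVf.
Qed.

Theorem corollary4p15 (k : fieldType) (n s : nat) (hs : (2 < s)%N)
  (F : 'I_s -> {mpoly k[n.+1]}) (F_inj : injective F)
  (F_form : forall i, exists d : nat, F i \is d.-homog for mdeg)
  (F_reg : forall i j l : 'I_s, i != j -> i != l -> j != l ->
     regular_sequence [:: F i; F j; F l])
  (m : nat) (hm : (1 <= m)%N) :
  [/\ minimal_generating_set (symbolic_power (star_ideal2 F) m) [set 0]
        (star_gens F 0 m),
      mu_eq (symbolic_power (star_ideal2 F) m) [set 0]
        (if odd m then s + s * m./2 else 1 + (m * s)./2)%N,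
      minimal_generating_set (symbolic_power (star_ideal2 F) m)
        (ideal_pow (star_ideal2 F) m) (star_gens F 1 m)
    & sdefect_eq (star_ideal2 F) m
        (if odd m then s * m./2 else 1 + s * (m./2 - 1))%N].
Proof.
have regs i j : i != j -> exists l, [/\ F i != 0, regular2 (F i) (F j),
    regular3 (F i) (F j) (F l) & ~ ideal_span [set` [:: F i; F j; F l]] 1].
  move=> ij; have [l /andP[li lj]] := third_index hs i j; exists l.
  by apply: regular_seq3P; apply: F_reg; rewrite // eq_sym.
have other i : exists j : 'I_s, i != j.
  by have [j /andP[ji _]] := third_index hs i i; exists j; rewrite eq_sym.
have F0 i : F i != 0 by have [j /regs[l []]] := other i.
have reg2 i j : i != j -> regular2 (F i) (F j) by move=> /regs[l []].
have reg3 i j l : i != j -> i != l -> j != l -> regular3 (F i) (F j) (F l).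
  by move=> ij il jl; case: (regular_seq3P (F_reg i j l ij il jl)).
pose ev : {rmorphism {mpoly k[n.+1]} -> k} := mcoeff 0%MM.
(* Otherwise [F i] would be a unit, and a regular sequence generates a proper ideal. *)
have evF i : ev (F i) = 0.
  apply/eqP; apply: contraT => Fi0; have [d hd] := F_form i.
  have [q eq1] := homog_mcoeff0 hd Fi0; have [j /regs[l [_ _ _]]] := other i.
  case; rewrite -eq1; apply: idealM; first exact: ideal_span_ideal.
  by apply: mem_ideal_span; rewrite /= mem_head.
have symE := symbolic_powerE F0 reg2 reg3 (@mpoly_noetherian k n.+1) m.
have zero_ideal : is_ideal [set 0 : {mpoly k[n.+1]}].
  by split=> [//|x y -> ->|a x ->]; rewrite /= ?addr0 ?mulr0.
have gens0E := @star_gens_range _ _ F hs 0 (uphalf m) m hm isT erefl.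
have gen0 : generates (symbolic_power (star_ideal2 F) m) [set 0] (range (@star_family _ _ F 0 (uphalf m) m)).
  rewrite -gens0E symE; split=> [|x hx]; first exact: star_pow_gens.
  by exists x; [apply: star_pow_span|rewrite /= subrr].
have free0 c := @star_family_free _ _ ev _ F hs F0 reg2 evF m c.
case: m hm => [//|m] hm in symE gens0E gen0 free0 *.
have gens1E := @star_gens_range _ _ F hs 1 m./2 m.+1 hm isT erefl.
have gen1 : generates (symbolic_power (star_ideal2 F) m.+1) (ideal_pow (star_ideal2 F) m.+1)
    (range (@star_family _ _ F 1 m./2 m.+1)).
  rewrite -gens1E symE; split=> [|x hx]; first exact: star_pow_gens.
  have := star_pow_span hs F0 reg2 reg3 hx; rewrite gens0E => /ideal_spanP[c].
  rewrite star_sumE big_ord_recl => ex.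
  (* The summands with [j = 0] lie in the ordinary power and can be dropped. *)
  pose c' (y : star_index s m./2 m.+1) := match y with
    | inl (j, i) => c (inl (lift ord0 j, i)) | inr l => c (inr l) end.
  exists (\sum_y c' y * star_family F 1 y); first by rewrite gens1E; apply/ideal_spanP; exists c'.
  have cancel (a b d e : {mpoly k[n.+1]}) : b + d = e -> a + b + d - e = a.
    by move=> <-; rewrite -(addrA a) addrK.
  rewrite star_sumE ex cancel //.
  have hI := ideal_pow_ideal (star_ideal2 F) m.+1.
  apply: ideal_sum => // i _; apply: idealM => //; rewrite mul1r.
  by apply: ideal_powX; rewrite star_ideal2E; apply: star_pow_prod_but.
have free1 c := @star_family_free_mod _ _ ev _ F hs F0 reg2 reg3 evF m c.
rewrite gens0E gens1E; split.
- exact: free_minimal gen0 free0.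
- have := free_mu zero_ideal gen0 free0; rewrite card_star_index; congr mu_eq.
  by rewrite -/(uphalf m.+1); case: ifP => om; have := odd_double_half m.+1; have := uphalf_half m.+1; rewrite om /=; nia.
- exact: free_minimal gen1 free1.
- have := free_mu (ideal_span_ideal _) gen1 free1; rewrite card_star_index /sdefect_eq; congr mu_eq.
  by case: ifP => om; have := odd_double_half m.+1; rewrite om /=; nia.
Qed.
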